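(* Let $\Lambda$ be a principal ideal domain in which linear equations are solvable, $I=\langle\nu\rangle$ a proper ideal of $\Lambda$, $R=\Lambda/I$, $T=\Lambda[x_1,\ldots,x_n]$, $A=R[x_1,\ldots,x_n]$, and let $\varphi:T\to A$ be the ring epimorphism $\sum_i\lambda_ix^{\alpha(i)}\mapsto\sum_i\overline\lambda_ix^{\alpha(i)}$, where $\overline\lambda=\lambda+I$. Fix a monomial ordering $\prec$. Let $\overline J$ be the ideal of $A$ generated by nonzero elements $\overline f_1,\ldots,\overline f_t$, where $\overline f_i=\sum_j\overline\lambda_{ij}x^{\alpha(j)}$ is written with nonzero coefficients represented by $\lambda_{ij}\in\Lambda$. Put $f_i=\sum_j\lambda_{ij}x^{\alpha(j)}\in T$, $S=\{f_1,\ldots,f_t,\nu\}$, and let $J=\langle S\rangle\subseteq T$. If $\mathcal G=\{g_1,\ldots,g_m\}$ is a strong Gröbner basis of $J$ with respect to $\prec$ constructed by the S-polynomial algorithm over a PID (recalled in the context) with initial input $S$, then: (i) the set $$\overline{\mathcal G}=\{\overline g_k=\varphi(g_k)\mid g_k\in\mathcal G,\ g_k\neq\nu\}=\varphi(\mathcal G)-\{0\}$$ is a strong Gröbner basis for $\overline J$; (ii) each $g_k\in\mathcal G-\{\nu\}$ has a representation $g_k=g_k'+g_k''$ with $g_k'=\sum_q\mu_{kq}x^{\alpha(q)}$, $\mu_{kq}\notin I$ for all $q$, and $g_k''=\sum_\ell\mu_{k\ell}x^{\alpha(\ell)}$, $\mu_{k\ell}\in I$ for all $\ell$, and such a representation can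 be algorithmically determined. Hence each element of $\overline{\mathcal G}$ has a representation $\overline g_k=\varphi(g_k)=\varphi(g_k')=\sum_q\overline\mu_{kq}x^{\alpha(q)}$ with all $\overline\mu_{kq}\neq0$.
   Context: Linear equations are solvable in $\Lambda$ if there are algorithms (1) deciding, for $\lambda,\lambda_1,\ldots,\lambda_m\in\Lambda$, whether $\lambda\in\langle\lambda_1,\ldots,\lambda_m\rangle$ and in that case computing $\mu_i$ with $\lambda=\sum\lambda_i\mu_i$, and (2) computing generators of the syzygy module $\{(\mu_i)\in\Lambda^m\mid\sum\lambda_i\mu_i=0\}$. For $0\neq f=\sum_{i=1}^m\lambda_ix^{\alpha(i)}$ with all $\lambda_i\ne0$ and $x^{\alpha(m)}\prec\cdots\prec x^{\alpha(1)}$: $\mathbf{LM}(f)=x^{\alpha(1)}$, $\mathbf{LC}(f)=\lambda_1$, $\mathbf{LT}(f)=\lambda_1x^{\alpha(1)}$. Strong Gröbner basis (over any commutative Noetherian coefficient ring $\Lambda$, likewise over $R$): a set $\mathcal G$ of nonzero elements of an ideal $J$ is a strong Gröbner basis for $J$ if for each $0\neq f\in J$ there exist $\lambda$ in the coefficient ring, a monomial $x^\alpha$ and $g_i\in\mathcal G$ such that $\mathbf{LT}(f)=\lambda x^\alpha\mathbf{LT}(g_i)$. Reduction: for a finite set $F$ of nonzero polynomials, $f\ne0$ reduces in one step modulo $F$ to $h=f-\sum_j\lambda_jx^{\alpha(j)}f_{i_j}$ if $f_{i_j}\in F$, $\lambda_j\ne0$, $\mathbf{LM}(f)=x^{\alpha(j)}\mathbf{LM}(f_{i_j})$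 for all $j$, and $\mathbf{LT}(f)=\sum_j\lambda_jx^{\alpha(j)}\mathbf{LT}(f_{i_j})$; $f\ne 0$ is minimal with respect to $F$ if no such step exists. S-polynomial algorithm over a PID, with input a finite set $S$ (zero elements discarded): start with $G:=S$. For every pair $f\ne g$ in $G$ (including pairs involving later-added elements) form the S-polynomial $\frac{cX}{\mathbf{LT}(f)}f-\frac{cX}{\mathbf{LT}(g)}g$, where $c=\mathrm{lcm}(\mathbf{LC}(f),\mathbf{LC}(g))$ and $X=\mathrm{lcm}(\mathbf{LM}(f),\mathbf{LM}(g))$, reduce it modulo the current $G$ to some $r$ that is $0$ or minimal with respect to $G$, and adjoin $r$ to $G$ if $r\neq0$. Stop when all pairs have been processed and output $G$. *)

(* Defs.v *)
From HB Require Import structures.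
From mathcomp Require Import all_boot all_order all_algebra.
From mathcomp Require Export ring_quotient.
From mathcomp Require Export mpoly.

Set Implicit Arguments.
Unset Strict Implicit.
Unset Printing Implicit Defensive.

Import GRing.Theory.
Local Open Scope ring_scope.
Local Open Scope quotient_scope.

(** * Ideals and linear equations *)

Definition lincomb (R : comNzRingType) (s c : seq R) : R :=
  \sum_(i < size s) s`_i * c`_i.

Definition gen_ideal (R : comNzRingType) (s : seq R) (x : R) : Prop :=
  exists2 c : seq R, size c = size s & x = lincomb s c.

Definition is_ideal (R : comNzRingType) (J : R -> Prop) : Prop :=
  [/\ J 0, forall x y, J x -> J y -> J (x + y) & forall a x, J x -> J (a * x)].

Definition is_pid (L : idomainType) : Prop :=
  forall J : L -> Prop, is_ideal J ->
    exists a : L, forall x, J x <-> gen_ideal [:: a] x.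

(* Solvability of linear equations: the two algorithms are data, and the
   programs below may only use them as black boxes. *)
Record lin_solver (L : comNzRingType) := LinSolver {
  solve_mem : L -> seq L -> option (seq L);
  solve_syz : seq L -> seq (seq L);
  solve_memP : forall (a : L) (s : seq L),
    match solve_mem a s with
    | Some c => size c = size s /\ a = lincomb s c
    | None => ~ gen_ideal s a
    end;
  solve_syzP : forall s : seq L,
    (forall z, z \in solve_syz s -> size z = size s /\ lincomb s z = 0) /\
    (forall c, size c = size s -> lincomb s c = 0 ->
       exists d : seq L, forall i, (i < size s)%N ->
         c`_i = \sum_(j < size (solve_syz s)) d`_j * (nth [::] (solve_syz s) j)`_i)
}.

(** * Leading terms and strong Groebner bases *)

(* [le m1 m2] reads x^m1 <= x^m2.  The last two conditions make [le] a
   well-ordering, by Dickson's lemma. *)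
Definition monomial_order (n : nat) (le : rel 'X_{1..n}) : Prop :=
  [/\ total le, antisymmetric le, transitive le,
      forall m, le 0%MM m
    & forall m m1 m2, le m1 m2 -> le (m + m1)%MM (m + m2)%MM].

(* The exponent of LM(p), meaningful for p != 0. *)
Definition lm (n : nat) (R : nzRingType) (le : rel 'X_{1..n})
    (p : {mpoly R[n]}) : 'X_{1..n} :=
  head 0%MM (sort (fun m1 m2 => le m2 m1) (msupp p)).

Definition lc (n : nat) (R : nzRingType) (le : rel 'X_{1..n})
    (p : {mpoly R[n]}) : R := p@_(lm le p).

Definition lt (n : nat) (R : nzRingType) (le : rel 'X_{1..n})
    (p : {mpoly R[n]}) : {mpoly R[n]} := lc le p *: 'X_[lm le p].

Definition strong_groebner (n : nat) (R : comNzRingType) (le : rel 'X_{1..n})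
    (J : {mpoly R[n]} -> Prop) (G : seq {mpoly R[n]}) : Prop :=
  (forall g, g \in G -> g != 0 /\ J g) /\
  (forall f, f != 0 -> J f ->
     exists (a : R) (m : 'X_{1..n}) (g : {mpoly R[n]}),
       g \in G /\ lt le f = a *: 'X_[m] * lt le g).

(** * Reduction *)

Definition red1 (n : nat) (R : comNzRingType) (le : rel 'X_{1..n})
    (F : seq {mpoly R[n]}) (f h : {mpoly R[n]}) : Prop :=
  f != 0 /\
  exists (k : nat) (a : 'I_k -> R) (m : 'I_k -> 'X_{1..n})
         (g : 'I_k -> {mpoly R[n]}),
    [/\ forall j, [/\ g j \in F, a j != 0 & lm le f = (m j + lm le (g j))%MM],
        lt le f = \sum_(j < k) a j *: 'X_[m j] * lt le (g j)
      & h = f - \sum_(j < k) a j *: 'X_[m j] * g j].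

Definition minimal (n : nat) (R : comNzRingType) (le : rel 'X_{1..n})
    (F : seq {mpoly R[n]}) (f : {mpoly R[n]}) : Prop :=
  f != 0 /\ ~ exists h, red1 le F f h.

Inductive reduces (n : nat) (R : comNzRingType) (le : rel 'X_{1..n})
    (F : seq {mpoly R[n]}) : {mpoly R[n]} -> {mpoly R[n]} -> Prop :=
| reduces_refl f : reduces le F f f
| reduces_step f h r : red1 le F f h -> reduces le F h r -> reduces le F f r.

(** * The S-polynomial algorithm over a PID *)

Definition is_lcm (L : idomainType) (a b c : L) : Prop :=
  [/\ exists u, c = u * a, exists v, c = v * b
    & forall d, (exists u, d = u * a) -> (exists v, d = v * b) ->
        exists w, d = w * c].

(* The lcm c of the leading coefficients is only defined up to a unit, hence a
   relation.  With c = u * LC(f) = v * LC(g), the quotients cX / LT(f) and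
   cX / LT(g) are the terms with coefficients u and v. *)
Definition is_spoly (n : nat) (L : idomainType) (le : rel 'X_{1..n})
    (f g h : {mpoly L[n]}) : Prop :=
  let X := mlcm (lm le f) (lm le g) in
  exists c u v : L,
    [/\ is_lcm (lc le f) (lc le g) c, c = u * lc le f, c = v * lc le g
      & h = u *: 'X_[X - lm le f] * f - v *: 'X_[X - lm le g] * g].

Definition treated (T : eqType) (P : seq (T * T)) (f g : T) : bool :=
  ((f, g) \in P) || ((g, f) \in P).

(* [spoly_run le G P G']: from the current set G, the pairs in P being already
   treated, the algorithm can stop with output G'.  The order in which pairs
   are treated, the lcms and the reductions are unspecified. *)
Inductive spoly_run (n : nat) (L : idomainType) (le : rel 'X_{1..n}) :
    seq {mpoly L[n]} -> seq ({mpoly L[n]} * {mpoly L[n]}) ->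
    seq {mpoly L[n]} -> Prop :=
| spoly_stop G P :
    (forall f g, f \in G -> g \in G -> f != g -> treated P f g) ->
    spoly_run le G P G
| spoly_pair G P f g h r G' :
    f \in G -> g \in G -> f != g -> ~~ treated P f g ->
    is_spoly le f g h -> reduces le G h r -> r = 0 \/ minimal le G r ->
    spoly_run le (if r == 0 then G else rcons G r) ((f, g) :: P) G' ->
    spoly_run le G P G'.

Definition spoly_algorithm (n : nat) (L : idomainType) (le : rel 'X_{1..n})
    (S G : seq {mpoly L[n]}) : Prop :=
  spoly_run le (undup [seq f <- S | f != 0]) [::] G.

(** * Reduction of coefficients modulo I *)

Definition mod_mpoly (n : nat) (L : comNzRingType) (I : idealr L)
    (p : {mpoly L[n]}) : {mpoly {ideal_quot I}[n]} :=
  map_mpoly (\pi_{ideal_quot I} : L -> {ideal_quot I}) p.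

(* f is obtained from fbar by choosing a representative of each of its nonzero
   coefficients. *)
Definition coef_lift (n : nat) (L : comNzRingType) (I : idealr L)
    (fbar : {mpoly {ideal_quot I}[n]}) (f : {mpoly L[n]}) : Prop :=
  msupp f =i msupp fbar /\
  forall m, m \in msupp fbar -> \pi_{ideal_quot I} f@_m = fbar@_m.

(** * Algorithms relative to a solver of linear equations *)

(* A model of computation in the style of the WHILE language: programs are
   closed syntax, common to all rings and numbers of variables, and work on
   binary trees whose leaves are DNil or ring elements.  Besides the tree
   operations they can use 0, 1, +, -, *, the zero test of the ring and the two
   algorithms of a [lin_solver].  DNil stands for false, the empty list, the
   number 0 and None. *)
Inductive data (L : Type) : Type :=
| DNil
| DElt of L
| DCons of data L & data L.
Arguments DNil {L}.

Inductive prog : Set :=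
| PId | PNil | PFst | PSnd
| PPair of prog & prog
| PSeq of prog & prog
| PIf of prog & prog & prog
| PWhile of prog & prog
| PZero | POne | PAdd | POpp | PMul | PIsZero
| PMem | PSyz.

Definition enc_bool (L : Type) (b : bool) : data L :=
  if b then DCons DNil DNil else DNil.

Definition enc_nat (L : Type) (k : nat) : data L := iter k (DCons DNil) DNil.

Definition enc_seq (L : Type) (s : seq (data L)) : data L :=
  foldr (@DCons L) DNil s.

Definition enc_elts (L : Type) (s : seq L) : data L :=
  enc_seq [seq DElt a | a <- s].

Definition enc_option (L : Type) (o : option (data L)) : data L :=
  if o is Some d then DCons d DNil else DNil.

Inductive eval (L : comNzRingType) (sol : lin_solver L) :
    prog -> data L -> data L -> Prop :=
| EId d : eval sol PId d d
| ENil d : eval sol PNil d DNil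
| EFst d e : eval sol PFst (DCons d e) d
| ESnd d e : eval sol PSnd (DCons d e) e
| EPair p q d x y : eval sol p d x -> eval sol q d y ->
    eval sol (PPair p q) d (DCons x y)
| ESeq p q d x y : eval sol p d x -> eval sol q x y -> eval sol (PSeq p q) d y
| EIfTrue b p q d x y : eval sol b d x -> x <> DNil -> eval sol p d y ->
    eval sol (PIf b p q) d y
| EIfFalse b p q d y : eval sol b d DNil -> eval sol q d y ->
    eval sol (PIf b p q) d y
| EWhileStop b p d : eval sol b d DNil -> eval sol (PWhile b p) d d
| EWhileStep b p d x y z : eval sol b d x -> x <> DNil -> eval sol p d y ->
    eval sol (PWhile b p) y z -> eval sol (PWhile b p) d z
| EZero d : eval sol PZero d (DElt 0)
| EOne d : eval sol POne d (DElt 1)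
| EAdd a b : eval sol PAdd (DCons (DElt a) (DElt b)) (DElt (a + b))
| EOpp a : eval sol POpp (DElt a) (DElt (- a))
| EMul a b : eval sol PMul (DCons (DElt a) (DElt b)) (DElt (a * b))
| EIsZero a : eval sol PIsZero (DElt a) (enc_bool L (a == 0))
| EMem a s : eval sol PMem (DCons (DElt a) (enc_elts s))
    (enc_option (omap (@enc_elts L) (solve_mem sol a s)))
| ESyz s : eval sol PSyz (enc_elts s)
    (enc_seq [seq enc_elts z | z <- solve_syz sol s]).

Definition enc_term (n : nat) (L : Type) (t : L * 'X_{1..n}) : data L :=
  DCons (DElt t.1) (enc_seq [seq enc_nat L k | k <- t.2]).

(* d lists, in some order, the terms of p, with nonzero coefficients and
   pairwise distinct monomials. *)
Definition encodes (n : nat) (L : comNzRingType) (p : {mpoly L[n]})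
    (d : data L) : Prop :=
  exists ts : seq (L * 'X_{1..n}),
    [/\ uniq [seq t.2 | t <- ts], forall t, t \in ts -> t.1 != 0,
        p = \sum_(t <- ts) t.1 *: 'X_[t.2]
      & d = enc_seq [seq enc_term t | t <- ts]].

(* Main.v *)
(* Since nu * T is contained in J, an element of Jbar lifts to an element of J
   none of whose coefficients lies in I: lift it and drop the terms with
   coefficients in I.  The leading term of this lift is a multiple of some
   LT(g) with LC(g) outside I, and phi commutes with taking leading terms of
   both.  No g <> nu in the output is killed by phi, because every remainder
   adjoined by the algorithm is irreducible modulo nu.  The splitting in (ii)
   tests each coefficient for membership in <nu>. *)
From HB Require Import structures.
Require Import Defs.
From mathcomp Require Import all_boot all_order all_algebra.
Import GRing.Theory.
Local Open Scope ring_scope.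
Local Open Scope quotient_scope.

Set Implicit Arguments.
Unset Strict Implicit.
Unset Printing Implicit Defensive.

Section Ideals.
Variable R : comNzRingType.
Implicit Types (J K : R -> Prop) (s : seq R) (x : R).

Lemma gen_ideal_ideal s : is_ideal (gen_ideal s).
Proof.
split.
- exists (nseq (size s) 0); first exact: size_nseq.
  by rewrite /lincomb big1 // => i _; rewrite nth_nseq if_same mulr0.
- move=> x y [c hc ->] [d hd ->].
  exists (mkseq (fun i => c`_i + d`_i) (size s)); first exact: size_mkseq.
  rewrite /lincomb -big_split /=; apply: eq_bigr => i _.
  by rewrite nth_mkseq // mulrDr.
- move=> a x [c hc ->].
  exists (mkseq (fun i => a * c`_i) (size s)); first exact: size_mkseq.
  rewrite /lincomb mulr_sumr; apply: eq_bigr => i _.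
  by rewrite nth_mkseq // mulrCA.
Qed.

Lemma mem_gen_ideal s x : x \in s -> gen_ideal s x.
Proof.
move=> xs; exists (mkseq (fun i => (i == index x s)%:R) (size s)).
  exact: size_mkseq.
have lt_i : (index x s < size s)%N by rewrite index_mem.
rewrite /lincomb (bigD1 (Ordinal lt_i)) //= nth_mkseq // eqxx mulr1 nth_index //.
rewrite big1 ?addr0 // => i ne_i; rewrite nth_mkseq //.
have /negPf -> : (i : nat) != index x s by [].
by rewrite mulr0.
Qed.

Lemma ideal_sum J (T : eqType) (r : seq T) (P : pred T) (F : T -> R) :
  is_ideal J -> (forall i, i \in r -> P i -> J (F i)) ->
  J (\sum_(i <- r | P i) F i).
Proof.
move=> [J0 JD _] JF; rewrite big_seq_cond.
by elim/big_ind: _ => // i /andP[ri Pi]; exact: JF.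
Qed.

Lemma gen_ideal_min K s x :
  is_ideal K -> (forall y, y \in s -> K y) -> gen_ideal s x -> K x.
Proof.
move=> idK sK [c _ ->]; apply: ideal_sum => // i _ _.
by case: idK => _ _ KM; rewrite mulrC; apply: KM; apply: sK; exact: mem_nth.
Qed.

Lemma gen_ideal1 a x : gen_ideal [:: a] x -> exists c, x = c * a.
Proof. by case=> c _ ->; exists c`_0; rewrite /lincomb big_ord1 mulrC. Qed.

End Ideals.

Section IdealMorphisms.
Variables (R R' : comNzRingType) (h : {rmorphism R -> R'}).

Lemma ideal_preim (K : R' -> Prop) : is_ideal K -> is_ideal (fun x => K (h x)).
Proof.
case=> K0 KD KM; split=> [|x y Kx Ky|a x Kx].
- by rewrite rmorph0.
- by rewrite rmorphD; exact: KD.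
- by rewrite rmorphM; exact: KM.
Qed.

Lemma ideal_im (J : R -> Prop) : (forall y, exists x, h x = y) ->
  is_ideal J -> is_ideal (fun y => exists2 x, J x & h x = y).
Proof.
move=> surj [J0 JD JM]; split=> [|_ _ [x Jx <-] [y Jy <-]|a _ [x Jx <-]].
- by exists 0; rewrite ?rmorph0.
- by exists (x + y); [exact: JD | exact: rmorphD].
by have [b <-] := surj a; exists (b * x); [exact: JM | exact: rmorphM].
Qed.

End IdealMorphisms.

Section LeadingTerm.
Variables (n : nat) (le : rel 'X_{1..n}).
Hypothesis hle : monomial_order le.

Lemma lm_max (R : nzRingType) (p : {mpoly R[n]}) : p != 0 ->
  lm le p \in msupp p /\ forall m, m \in msupp p -> le m (lm le p).
Proof.
case: hle => tot _ tr _ _; rewrite -msupp_eq0 /lm.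
set leR := fun m1 m2 => le m2 m1.
have totR : total leR by move=> a b; exact: tot.
have trR : transitive leR by move=> b a c /= ab bc; exact: tr bc ab.
have := sort_sorted totR (msupp p).
have memS := mem_sort leR (msupp p).
case: (sort leR (msupp p)) memS => [|m0 s] memS /=.
  by move=> _; case: (msupp p) memS => // m1 r /(_ m1); rewrite inE eqxx.
move=> /(order_path_min trR)/allP min0 _; split.
  by rewrite -memS mem_head.
move=> m; rewrite -memS inE => /orP[/eqP ->|]; last exact: min0.
by have := tot m0 m0; rewrite orbb.
Qed.

Lemma lm_uniq (R : nzRingType) (p : {mpoly R[n]}) m : m \in msupp p ->
  (forall m', m' \in msupp p -> le m' m) -> lm le p = m.
Proof.
move=> mp max_m; have p0 : p != 0.
  by apply: contraTneq mp => ->; rewrite msupp0.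
have [mem_lm max_lm] := lm_max p0.
by case: hle => _ anti _ _ _; apply: anti; rewrite max_m ?max_lm.
Qed.

Lemma lc_neq0 (R : nzRingType) (p : {mpoly R[n]}) : p != 0 -> lc le p != 0.
Proof. by move=> /lm_max[]; rewrite mcoeff_msupp. Qed.

Lemma lmC (R : nzRingType) (c : R) : lm le c%:MP = 0%MM.
Proof.
have [->|c0] := eqVneq c 0; first by rewrite /lm msupp0.
by rewrite /lm msuppC (negPf c0).
Qed.

Lemma lt_coef (R : nzRingType) (p : {mpoly R[n]}) : (lt le p)@_(lm le p) = lc le p.
Proof. by rewrite /lt mcoeffZ mcoeffX eqxx mulr1. Qed.

Lemma lt_mul_termP (R : comNzRingType) (f g : {mpoly R[n]}) a m : f != 0 ->
  lt le f = a *: 'X_[m] * lt le g <->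
  lc le f = a * lc le g /\ lm le f = (m + lm le g)%MM.
Proof.
move=> f0; have -> : a *: 'X_[m] * lt le g = (a * lc le g) *: 'X_[m + lm le g].
  by rewrite /lt -scalerAl -scalerAr scalerA -mpolyXD.
split=> [E|[Elc Elm]]; last by rewrite /lt Elc Elm.
have Elm : lm le f = (m + lm le g)%MM.
  have := lt_coef f; rewrite E mcoeffZ mcoeffX; case: eqP => [//|_].
  by rewrite mulr0 => E0; have := lc_neq0 f0; rewrite -E0 eqxx.
by split=> //; rewrite -lt_coef E Elm mcoeffZ mcoeffX eqxx mulr1.
Qed.

Lemma lc_minimal (R : comNzRingType) (G : seq {mpoly R[n]}) (r : {mpoly R[n]}) c a :
  c%:MP \in G -> minimal le G r -> lc le r != a * c.
Proof.
move=> Gc [r0 irr]; apply/eqP => Elc; apply: irr.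
have a0 : a != 0.
  by apply: contraTneq (lc_neq0 r0) => a0; rewrite Elc a0 mul0r eqxx.
exists (r - \sum_(j < 1) a *: 'X_[lm le r] * c%:MP); split=> //.
exists 1%N, (fun=> a), (fun=> lm le r), (fun=> c%:MP); split=> //.
  by move=> _; split=> //; rewrite lmC addm0.
rewrite big_ord1 /lt lmC Elc mpolyX0 /lc lmC mcoeffC eqxx mulr1.
by rewrite -scalerAl -scalerAr scalerA mulr1.
Qed.

End LeadingTerm.

Lemma uniq_map_inj_in (T1 T2 : eqType) (h : T1 -> T2) (s : seq T1) :
  uniq [seq h x | x <- s] -> {in s &, injective h}.
Proof.
elim: s => //= z s IH /andP[hz us] x y; rewrite !inE.
case/orP => [/eqP ->|sx] /orP[/eqP -> //|sy] E; last exact: IH.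
  by rewrite E map_f in hz.
by rewrite -E map_f in hz.
Qed.

Section CoefPart.
Variables (n : nat) (R : comNzRingType).
Implicit Types (p : {mpoly R[n]}) (P : pred R).

Definition coef_part P p : {mpoly R[n]} :=
  \sum_(m <- msupp p | P p@_m) p@_m *: 'X_[m].

Lemma mcoeff_coef_part P p m :
  (coef_part P p)@_m = if P p@_m then p@_m else 0.
Proof.
rewrite raddf_sum /= big_mkcond /=.
rewrite (eq_bigr (fun k => if k == m then (if P p@_m then p@_m else 0) else 0));
  last first.
  move=> k _; rewrite mcoeffZ mcoeffX.
  by case: (eqVneq k m) => [->|_]; rewrite ?mulr1 ?mulr0 ?if_same.
rewrite -big_mkcond /= big_const_seq /=.
have [mp|mp] := boolP (m \in msupp p).
  by rewrite count_uniq_mem ?msupp_uniq // mp /= addr0.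
by rewrite (memN_msupp_eq0 mp) if_same; elim: count => //= k ->; rewrite addr0.
Qed.

Lemma msupp_coef_part P p m :
  (m \in msupp (coef_part P p)) = (m \in msupp p) && P p@_m.
Proof.
by rewrite !mcoeff_msupp mcoeff_coef_part; case: ifP; rewrite ?andbT ?andbF ?eqxx.
Qed.

Lemma coef_partC P p : p = coef_part (predC P) p + coef_part P p.
Proof.
apply/mpolyP => m; rewrite mcoeffD !mcoeff_coef_part /=.
by case: (P _); rewrite /= ?add0r ?addr0.
Qed.

Lemma encodes_coef_part P p (ts : seq (R * 'X_{1..n})) :
  uniq [seq t.2 | t <- ts] -> (forall t, t \in ts -> t.1 != 0) ->
  p = \sum_(t <- ts) t.1 *: 'X_[t.2] ->
  encodes (coef_part P p)
    (enc_seq [seq enc_term t | t <- catrev [seq t <- ts | P t.1] [::]]).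
Proof.
move=> uts nz Ep.
have coefp t : t \in ts -> p@_t.2 = t.1.
  move=> ts_t; rewrite Ep raddf_sum /= (bigD1_seq t) ?(map_uniq uts) //=.
  rewrite mcoeffZ mcoeffX eqxx mulr1 big_seq_cond big1 ?addr0 //.
  move=> u /andP[ts_u ne_ut]; rewrite mcoeffZ mcoeffX.
  case: eqP => [E|]; last by rewrite mulr0.
  by rewrite (uniq_map_inj_in uts ts_u ts_t E) eqxx in ne_ut.
have supp : perm_eq (msupp p) [seq t.2 | t <- ts].
  apply: uniq_perm; rewrite ?msupp_uniq // => m; apply/idP/idP.
    apply: contraTT => ntm; rewrite mcoeff_msupp negbK Ep raddf_sum /=.
    rewrite big_seq big1 // => t ts_t; rewrite mcoeffZ mcoeffX.
    case: eqP => [E|]; last by rewrite mulr0.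
    by case/mapP: ntm; exists t.
  by case/mapP => t ts_t ->; rewrite mcoeff_msupp coefp // nz.
rewrite catrevE cats0; exists (rev [seq t <- ts | P t.1]); split=> //.
- rewrite map_rev rev_uniq; apply: subseq_uniq uts.
  by apply: map_subseq; exact: filter_subseq.
- by move=> t; rewrite mem_rev mem_filter => /andP[_ /nz].
rewrite /coef_part (perm_big _ supp) big_map /= big_rev big_filter /=.
rewrite big_seq_cond [RHS]big_seq_cond; apply: eq_big => [t|t /andP[ts_t _]].
  by case: (boolP (t \in ts)) => //= /coefp ->.
by rewrite coefp.
Qed.

End CoefPart.

Section Quotient.
Variables (n : nat) (L : comNzRingType) (I : idealr L).
Local Notation Q := {ideal_quot I}.
Local Notation phi := (@mod_mpoly n L I).

Lemma pi_eq0 (a : L) : (\pi_Q a == 0) = (a \in I).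
Proof. by rewrite -[0](rmorph0 \pi_Q) -Quotient.idealrBE subr0. Qed.

Lemma mcoeff_mod (p : {mpoly L[n]}) m : (phi p)@_m = \pi_Q p@_m.
Proof. exact: mcoeff_map_mpoly. Qed.

HB.instance Definition _ := GRing.RMorphism.copy phi (map_mpoly \pi_Q).

Lemma mod_eq0 (p : {mpoly L[n]}) : phi p = 0 <-> forall m, p@_m \in I.
Proof.
split=> [E m|pI]; first by rewrite -pi_eq0 -mcoeff_mod E mcoeff0.
by apply/mpolyP => m; rewrite mcoeff_mod mcoeff0; apply/eqP; rewrite pi_eq0.
Qed.

Lemma mod_surj (q : {mpoly Q[n]}) : exists p, phi p = q.
Proof.
exists (\sum_(m <- msupp q) repr q@_m *: 'X_[m]).
rewrite [RHS]mpolyE /mod_mpoly raddf_sum; apply: eq_bigr => m _.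
by rewrite /= map_mpolyZ map_mpolyX /= reprK.
Qed.

Lemma mod_coef_lift (fbar : {mpoly Q[n]}) (f : {mpoly L[n]}) :
  coef_lift fbar f -> phi f = fbar.
Proof.
case=> supp coef; apply/mpolyP => m; rewrite mcoeff_mod.
have [/coef //|mf] := boolP (m \in msupp fbar).
by rewrite (memN_msupp_eq0 mf) memN_msupp_eq0 ?supp // rmorph0.
Qed.

Lemma mod_coef_part (p : {mpoly L[n]}) :
  phi (coef_part [predC I] p) = phi p.
Proof.
have inside0 : phi (coef_part [in I] p) = 0.
  by apply/mod_eq0 => m; rewrite mcoeff_coef_part; case: ifP; rewrite ?idealr0.
by rewrite [in RHS](coef_partC [in I] p) rmorphD [X in _ + X]inside0 addr0.
Qed.

Lemma lm_mod le (p : {mpoly L[n]}) : monomial_order le -> p != 0 ->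
  lc le p \notin I ->
  [/\ phi p != 0, lm le (phi p) = lm le p & lc le (phi p) = \pi_Q (lc le p)].
Proof.
move=> hle p0 pI; have [_ max_p] := lm_max hle p0.
have lm_in : lm le p \in msupp (phi p) by rewrite mcoeff_msupp mcoeff_mod pi_eq0.
have Elm : lm le (phi p) = lm le p.
  apply: (lm_uniq hle) => // m; rewrite mcoeff_msupp mcoeff_mod => pm.
  apply: max_p; rewrite mcoeff_msupp; apply: contraNneq pm => ->.
  by rewrite rmorph0.
split=> //; last by rewrite /lc Elm mcoeff_mod.
by apply: contraTneq lm_in => ->; rewrite msupp0.
Qed.

End Quotient.

Section Program.

(* The loop runs on states (nu, (terms left, (terms outside I, terms in I))). *)
Let remaining := PSeq PSnd PFst.
Let term := PSeq remaining PFst.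
Let outside := PSeq PSnd (PSeq PSnd PFst).
Let inside := PSeq PSnd (PSeq PSnd PSnd).

Definition split_test : prog :=
  PSeq (PPair (PSeq term PFst) (PPair PFst PNil)) PMem.

Definition split_step : prog :=
  PPair PFst (PPair (PSeq remaining PSnd)
    (PIf split_test
      (PPair outside (PPair term inside))
      (PPair (PPair term outside) inside))).

Definition split_loop : prog := PWhile remaining split_step.

Definition split_prog : prog :=
  PSeq (PPair PFst (PPair PSnd (PPair PNil PNil)))
       (PSeq split_loop (PSeq PSnd PSnd)).

Variables (L : comNzRingType) (sol : lin_solver L) (nu : L) (I : {pred L}).
Hypothesis hI : forall a : L, a \in I <-> gen_ideal [:: nu] a.
Variable n : nat.

Let state (ts a b : seq (L * 'X_{1..n})) : data L :=
  DCons (DElt nu) (DCons (enc_seq [seq enc_term t | t <- ts])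
    (DCons (enc_seq [seq enc_term t | t <- a])
           (enc_seq [seq enc_term t | t <- b]))).

Lemma eval_mem_ideal (a : L) : exists d,
  eval sol PMem (DCons (DElt a) (DCons (DElt nu) DNil)) d /\
  (if a \in I then d <> DNil else d = DNil).
Proof.
eexists; split; first exact: (EMem sol a [:: nu]).
have := solve_memP sol a [:: nu]; case: (solve_mem _ _ _) => [c [sz Ea]|nI] /=.
  by have -> : a \in I by apply/hI; exists c.
by case: ifP => // /hI /nI.
Qed.

Lemma eval_split_step t ts a b :
  eval sol split_step (state (t :: ts) a b)
    (if t.1 \in I then state ts a (t :: b) else state ts (t :: a) b).
Proof.
have [d [ev_d d_nil]] := eval_mem_ideal t.1.
have ev_test : eval sol split_test (state (t :: ts) a b) d.
  by apply: ESeq ev_d; repeat econstructor.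
case: ifP d_nil => _ d_nil; apply: EPair; try exact: EFst;
  apply: EPair; try by repeat econstructor.
  by apply: EIfTrue ev_test d_nil _; repeat econstructor.
by rewrite d_nil in ev_test; apply: EIfFalse ev_test _; repeat econstructor.
Qed.

Lemma eval_split_loop ts a b :
  eval sol split_loop (state ts a b)
    (state [::] (catrev [seq t <- ts | t.1 \notin I] a)
                (catrev [seq t <- ts | t.1 \in I] b)).
Proof.
elim: ts a b => [|t ts IH] a b.
  by apply: EWhileStop; repeat econstructor.
apply: EWhileStep (eval_split_step t ts a b) _.
- by repeat econstructor.
- by [].
by rewrite /=; case: (t.1 \in I); exact: IH.
Qed.

Lemma eval_split_prog (p : {mpoly L[n]}) d : encodes p d ->
  exists d' d'' : data L,
    [/\ eval sol split_prog (DCons (DElt nu) d) (DCons d' d''),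
        encodes (coef_part [predC I] p) d' & encodes (coef_part [in I] p) d''].
Proof.
case=> ts [uts nz Ep ->].
exists (enc_seq [seq enc_term t | t <- catrev [seq t <- ts | t.1 \notin I] [::]]).
exists (enc_seq [seq enc_term t | t <- catrev [seq t <- ts | t.1 \in I] [::]]).
split; try exact: encodes_coef_part.
apply: ESeq; first by repeat econstructor.
by apply: ESeq; [exact: (eval_split_loop ts [::] [::]) | repeat econstructor].
Qed.

End Program.

Section Algorithm.
Variables (L : idomainType) (nu : L) (I : idealr L).
Hypothesis hI : forall a : L, a \in I <-> gen_ideal [:: nu] a.
Variables (n : nat) (le : rel 'X_{1..n}).
Hypothesis hle : monomial_order le.
Local Notation phi := (@mod_mpoly n L I).

Lemma mod_minimal_neq0 (G : seq {mpoly L[n]}) r :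
  (nu != 0 -> nu%:MP \in G) -> minimal le G r -> phi r != 0.
Proof.
move=> Gnu rmin; have [r0 _] := rmin.
apply/negP => /eqP/mod_eq0/(_ (lm le r))/hI/gen_ideal1[c Ec].
have [nu0|/Gnu Gn] := eqVneq nu 0; last first.
  by have := lc_minimal hle c Gn rmin; rewrite /lc Ec eqxx.
by have := lc_neq0 hle r0; rewrite /lc Ec nu0 mulr0 eqxx.
Qed.

Lemma spoly_run_mod_neq0 (G G' : seq {mpoly L[n]}) P :
  spoly_run le G P G' ->
  (nu != 0 -> nu%:MP \in G) ->
  (forall g, g \in G -> g != nu%:MP -> phi g != 0) ->
  forall g, g \in G' -> g != nu%:MP -> phi g != 0.
Proof.
elim=> // {}G {}P f g h r {}G' _ _ _ _ _ _ rmin _ IH Gnu Gphi.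
case: (eqVneq r 0) IH rmin => [_ IH _|r0 IH]; first exact: IH.
case=> [r0'|rmin]; first by rewrite r0' eqxx in r0.
apply: IH => [nu0|k]; first by rewrite mem_rcons inE Gnu ?orbT.
rewrite mem_rcons inE => /orP[/eqP -> _|]; last exact: Gphi.
exact: mod_minimal_neq0 rmin.
Qed.

Section Generators.
Variables (t : nat) (fbar : 'I_t -> {mpoly {ideal_quot I}[n]}).
Variable f : 'I_t -> {mpoly L[n]}.
Hypothesis hf : forall i, coef_lift (fbar i) (f i).
Let Jbar := gen_ideal [seq fbar i | i <- enum 'I_t].
Let S := rcons [seq f i | i <- enum 'I_t] nu%:MP.
Let J := gen_ideal S.

Lemma mod_const : phi nu%:MP = 0.
Proof.
apply/mod_eq0 => m; rewrite mcoeffC mulrC; apply: idealMr.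
by apply/hI/mem_gen_ideal; exact: mem_head.
Qed.

Lemma mod_gen_ideal p : J p -> Jbar (phi p).
Proof.
have idK : is_ideal (fun p => Jbar (phi p)).
  exact: (ideal_preim (phi : {rmorphism _ -> _}) (gen_ideal_ideal _)).
apply: (gen_ideal_min idK) => q.
rewrite mem_rcons inE => /orP[/eqP ->|/mapP[i _ ->]].
  by rewrite mod_const; case: (gen_ideal_ideal [seq fbar i | i <- enum 'I_t]).
by rewrite (mod_coef_lift (hf i)); apply/mem_gen_ideal/map_f; rewrite mem_enum.
Qed.

Lemma gen_ideal_mod_lift q : Jbar q -> exists2 p, J p & phi p = q.
Proof.
have idK : is_ideal (fun q => exists2 p, J p & phi p = q).
  exact: (ideal_im (@mod_surj _ _ I) (gen_ideal_ideal S)).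
apply: (gen_ideal_min idK) => _ /mapP[i i_t ->]; exists (f i); last exact: mod_coef_lift.
by apply: mem_gen_ideal; rewrite mem_rcons inE map_f ?orbT.
Qed.

Lemma coef_part_gen_ideal p : J p -> J (coef_part [predC I] p).
Proof.
have idJ := gen_ideal_ideal S; have [_ JD JM] := idJ.
move=> Jp; have -> : coef_part [predC I] p = p + (-1) * coef_part [in I] p.
  by rewrite {2}[p](coef_partC [in I]) mulN1r addrK.
apply: JD => //; apply: (JM); apply: ideal_sum => // m _ /hI/gen_ideal1[c ->].
have -> : (c * nu) *: 'X_[m] = c *: 'X_[m] * nu%:MP :> {mpoly L[n]}.
  by rewrite [RHS]mulrC mul_mpolyC scalerA mulrC.
by apply/JM/mem_gen_ideal; rewrite /S mem_rcons mem_head.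
Qed.

Lemma strong_groebner_mod (G : seq {mpoly L[n]}) :
  strong_groebner le J G ->
  (forall g, g \in G -> g != nu%:MP -> phi g != 0) ->
  strong_groebner le Jbar [seq phi g | g <- G & g != nu%:MP].
Proof.
move=> [GJ GT] Gphi; split=> [_ /mapP[g gG ->]|q q0 Jq].
  move: gG; rewrite mem_filter => /andP[gnu Gg]; split; first exact: Gphi.
  by apply: mod_gen_ideal; case: (GJ g Gg).
have [p [Jp Ep pn0 lcpI]] : exists p,
    [/\ J p, phi p = q, p != 0 & lc le p \notin I].
  have [p0 Jp0 Ep0] := gen_ideal_mod_lift Jq.
  have Ep : phi (coef_part [predC I] p0) = q by rewrite mod_coef_part.
  have pn0 : coef_part [predC I] p0 != 0.
    apply: contraNneq q0 => p00; rewrite -Ep p00.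
    by apply/eqP/mod_eq0 => m; rewrite mcoeff0 idealr0.
  exists (coef_part [predC I] p0); split=> //; first exact: coef_part_gen_ideal.
  have [] := lm_max hle pn0.
  rewrite msupp_coef_part => /andP[_ /=] lcI _.
  by rewrite /lc mcoeff_coef_part /= lcI.
have [a [m [g [Gg E]]]] := GT p pn0 Jp.
have [Elc Elm] := (lt_mul_termP hle _ _ _ pn0).1 E.
have lcgI : lc le g \notin I.
  by apply: contra lcpI; rewrite Elc; exact: idealMr.
have g0 : g != 0 by case: (GJ g Gg).
have [_ Elmg Elcg] := lm_mod hle g0 lcgI.
have [phip0 Elmp Elcp] := lm_mod hle pn0 lcpI.
exists (\pi_{ideal_quot I} a), m, (phi g); split.
  apply: map_f; rewrite mem_filter Gg andbT.
  apply: contraNneq lcgI => ->; rewrite /lc mcoeffC mulrC.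
  by apply/idealMr/hI/mem_gen_ideal; exact: mem_head.
rewrite -Ep; apply/(lt_mul_termP hle _ _ _ phip0); split.
  have Epi : \pi_{ideal_quot I} (a * lc le g) =
             \pi_{ideal_quot I} a * \pi_{ideal_quot I} (lc le g).
    exact: rmorphM.
  (* Rewriting here would make unification compare L with its quotient. *)
  exact (etrans Elcp (etrans (congr1 _ Elc)
           (etrans Epi (congr1 (GRing.mul _) (esym Elcg))))).
exact (etrans Elmp (etrans Elm (congr1 (mnm_add m) (esym Elmg)))).
Qed.

End Generators.
End Algorithm.

Theorem theorem3p2 :
  exists prg : prog,
  forall (L : idomainType) (hL : is_pid L) (sol : lin_solver L)
    (nu : L) (I : idealr L) (hI : forall a : L, a \in I <-> gen_ideal [:: nu] a)
    (n : nat) (le : rel 'X_{1..n}) (hle : monomial_order le)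
    (t : nat) (fbar : 'I_t -> {mpoly {ideal_quot I}[n]})
    (hfbar : forall i, fbar i != 0)
    (f : 'I_t -> {mpoly L[n]}) (hf : forall i, coef_lift (fbar i) (f i)),
  let phi : {mpoly L[n]} -> {mpoly {ideal_quot I}[n]} := @mod_mpoly n L I in
  let Jbar := gen_ideal [seq fbar i | i <- enum 'I_t] in
  let S := rcons [seq f i | i <- enum 'I_t] nu%:MP in
  let J := gen_ideal S in
  forall (G : seq {mpoly L[n]})
    (hrun : spoly_algorithm le S G) (hG : strong_groebner le J G),
  let Gbar := [seq phi g | g <- G & g != nu%:MP] in
  ((Gbar =i [seq h <- [seq phi g | g <- G] | h != 0]) /\
   strong_groebner le Jbar Gbar) /\
  (forall g : {mpoly L[n]}, g \in G -> g != nu%:MP ->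
     exists g' g'' : {mpoly L[n]},
       [/\ [/\ g = g' + g'',
               forall m, m \in msupp g' -> g'@_m \notin I
             & forall m, m \in msupp g'' -> g''@_m \in I],
           forall d, encodes g d ->
             exists d' d'' : data L,
               [/\ eval sol prg (DCons (DElt nu) d) (DCons d' d''),
                   encodes g' d' & encodes g'' d'']
         & [/\ phi g = phi g',
               phi g' = \sum_(m <- msupp g') \pi_{ideal_quot I} g'@_m *: 'X_[m]
             & forall m, m \in msupp g' -> \pi_{ideal_quot I} g'@_m != 0]]).
Proof.
exists split_prog => L _ sol nu I hI n le hle t fbar fbar0 f hf phi Jbar S J G
  run GJ Gbar.
have Gphi : forall g, g \in G -> g != nu%:MP -> phi g != 0.
  apply: (spoly_run_mod_neq0 hI hle run) => [nu0|g].
    by rewrite mem_undup mem_filter mpolyC_eq0 nu0 mem_rcons mem_head.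
  rewrite mem_undup mem_filter => /andP[_]; rewrite mem_rcons inE.
  case/orP => [->//|/mapP[i _ ->] _].
  by rewrite /phi (mod_coef_lift (hf i)).
split.
  split; last exact: strong_groebner_mod.
  move=> h; apply/mapP/idP.
    case=> g; rewrite mem_filter => /andP[gnu Gg] ->.
    by rewrite mem_filter Gphi //= map_f.
  rewrite mem_filter => /andP[h0 /mapP[g Gg Eh]]; exists g => //.
  rewrite mem_filter Gg andbT; apply: contraNneq h0 => gnu.
  by rewrite Eh gnu; apply/eqP; exact: mod_const.
move=> g Gg gnu; exists (coef_part [predC I] g), (coef_part [in I] g).
have outside m : m \in msupp (coef_part [predC I] g) ->
    (coef_part [predC I] g)@_m \notin I.
  rewrite msupp_coef_part => /andP[_ gI].
  by rewrite mcoeff_coef_part gI.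
split; last split.
- split=> //; first exact: coef_partC.
  move=> m; rewrite msupp_coef_part => /andP[_ gI].
  by rewrite mcoeff_coef_part gI.
- exact: eval_split_prog.
- by symmetry; exact: mod_coef_part.
- rewrite {1}(mpolyE (coef_part [predC I] g)) /phi raddf_sum.
  apply: eq_bigr => m _.
  exact: etrans (map_mpolyZ _ _ _) (congr1 _ (map_mpolyX _ _)).
by move=> m /outside; rewrite -pi_eq0.
Qed.
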